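(* There exists a quadratic Leibman sequence $T=(T_k:k\in\mathbb Z)$ (in some group $G$ with identity $I$) with $T_0=I$ whose range $\{T_k:k\in\mathbb Z\}$ generates a non-nilpotent group.
   Context: For a group $G$, a sequence $T:\mathbb Z\to G$ and $i\in\mathbb Z$, the discrete difference $\Delta^iT:\mathbb Z\to G$ is $(\Delta^iT)_j=T_{i+j}T_j^{-1}$. $T$ is a Leibman sequence of degree at most $d\in\mathbb N$ if $\Delta^{i_d}\cdots\Delta^{i_1}\Delta^{i_0}T$ is the constant sequence with value the identity of $G$, for all $i_0,\dots,i_d\in\mathbb Z$. Quadratic means of degree at most $2$. *)

(* Defs.v *)
From HB Require Import structures.
From mathcomp Require Import all_boot all_order all_algebra.
From mathcomp Require Import boolp classical_sets.

Set Implicit Arguments.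
Unset Strict Implicit.
Unset Printing Implicit Defensive.

Local Open Scope classical_set_scope.
Local Open Scope group_scope.

Definition discrete_diff (G : groupType) (i : int) (T : int -> G) : int -> G :=
  fun j => T (i + j)%R * (T j)^-1.

(* The head of the sequence is the increment applied first, so that the
   list [:: i0; ...; id] yields Delta^{id} ... Delta^{i0} T. *)
Definition iter_diff (G : groupType) (s : seq int) (T : int -> G) : int -> G :=
  foldl (fun S i => discrete_diff i S) T s.

Definition leibman (G : groupType) (d : nat) (T : int -> G) : Prop :=
  forall (s : d.+1.-tuple int) (j : int), iter_diff s T j = 1.

(* MathComp's subgroup and nilpotency theory only covers finite groups, and its
   [group_closed] only boolean predicates; subgroups of an arbitrary group are
   handled here as Prop-valued sets. *)
Definition is_subgroup (G : groupType) (H : set G) : Prop :=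
  [/\ H 1, (forall x y, H x -> H y -> H (x * y)) & (forall x, H x -> H x^-1)].

Definition generated (G : groupType) (A : set G) : set G :=
  smallest (@is_subgroup G) A.

Definition commutator_subgroup (G : groupType) (A B : set G) : set G :=
  generated [set [~ x, y] | x in A & y in B].

Definition lower_central (G : groupType) (n : nat) (H : set G) : set G :=
  iter n (fun K => commutator_subgroup K H) H.

Definition nilpotent_subgroup (G : groupType) (H : set G) : Prop :=
  exists n, lower_central n H = [set 1].

(* Main.v *)
(** In the infinite dihedral group of the maps [x |-> n + (-1)^s x] of [int],
    take [T_n : x |-> n + (-1)^n x].  Then [T_(i+j) T_j^-1] is the constant
    translation by [i] for even [i], and the reflection [x |-> i + 2j - x] for
    odd [i]; a further difference by [k] gives the constant translation by [0],
    resp. [2k].  Commuting a translation by [x] with the reflection [T_1] gives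
    the translation by [-2x], so the lower central series never dies out. *)

From HB Require Import structures.
Require Import Defs.
From mathcomp Require Import all_boot all_order all_algebra.
From mathcomp Require Import boolp classical_sets.
From mathcomp Require Import zify.

(* [(n, s)] stands for the map [x |-> n + (-1)^s x]. *)
Definition dihedral : Type := (int * bool)%type.

Definition dihedral_mul (u v : dihedral) : dihedral :=
  ((u.1 + (if u.2 then - v.1 else v.1))%R, u.2 (+) v.2).

(** Reflections are involutions, hence the unchanged first component. *)
Definition dihedral_inv (u : dihedral) : dihedral :=
  ((if u.2 then u.1 else - u.1)%R, u.2).

Definition dihedral_one : dihedral := (0%R, false).

Lemma dihedral_mulA : associative dihedral_mul.
Proof.
by move=> [m [|]] [n [|]] [p s]; rewrite /dihedral_mul /= ?negbK; congr pair; lia.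
Qed.

Lemma dihedral_mul1 : left_id dihedral_one dihedral_mul.
Proof. by move=> [n s]; rewrite /dihedral_mul /= GRing.add0r. Qed.

Lemma dihedral_mulr1 : right_id dihedral_one dihedral_mul.
Proof. by move=> [n [|]]; rewrite /dihedral_mul /=; congr pair; lia. Qed.

Lemma dihedral_mulV : left_inverse dihedral_one dihedral_inv dihedral_mul.
Proof.
by move=> [n [|]]; rewrite /dihedral_mul /dihedral_one /=; congr pair; lia.
Qed.

Lemma dihedral_mulrV : right_inverse dihedral_one dihedral_inv dihedral_mul.
Proof.
by move=> [n [|]]; rewrite /dihedral_mul /dihedral_one /=; congr pair; lia.
Qed.

HB.instance Definition _ := Choice.on dihedral.
HB.instance Definition _ := isGroup.Build dihedral
  dihedral_mulA dihedral_mul1 dihedral_mulr1 dihedral_mulV dihedral_mulrV.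

Local Open Scope group_scope.

Lemma dihedralME (u v : dihedral) : u * v = dihedral_mul u v.
Proof. by []. Qed.

Lemma dihedralVE (u : dihedral) : u^-1 = dihedral_inv u.
Proof. by []. Qed.

Lemma sub_generated (G : groupType) (A : set G) (x : G) : A x -> generated A x.
Proof. by move=> Ax M [_]; apply. Qed.

Definition quad_seq (n : int) : dihedral := (n, odd `|n|%N).

(** Parity is additive, so the sign depends on [i] alone; the two shifts by [j] cancel for even [i]
    and add up for odd [i]. *)
Lemma diff_quad_seq (i j : int) :
  discrete_diff i quad_seq j
  = ((i + (if odd `|i|%N then j + j else 0))%R, odd `|i|%N) :> dihedral.
Proof.
rewrite /discrete_diff /quad_seq !(dihedralME, dihedralVE) /dihedral_mul /dihedral_inv /=.
have -> : odd `|(i + j)%R|%N = odd `|i|%N (+) odd `|j|%N by lia.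
by case: (odd `|i|%N); case: (odd `|j|%N) => /=; congr pair; lia.
Qed.

(** With [j] gone from the value, one more difference is trivial. *)
Lemma diff2_quad_seq (i k j : int) :
  discrete_diff k (discrete_diff i quad_seq) j
  = ((if odd `|i|%N then k + k else 0)%R, false) :> dihedral.
Proof.
rewrite {1}/discrete_diff !diff_quad_seq.
rewrite !(dihedralME, dihedralVE) /dihedral_mul /dihedral_inv /=.
by case: (odd `|i|%N) => /=; congr pair; lia.
Qed.

Lemma quad_seq_leibman : leibman 2 quad_seq.
Proof.
move=> [[|i [|k [|l []]]] //= _] j.
by rewrite /iter_diff /= {1}/discrete_diff !diff2_quad_seq mulgV.
Qed.

(** Conjugation by a reflection inverts a translation. *)
Lemma commg_translation (x : int) :
  [~ ((x, false) : dihedral), quad_seq 1] = ((- (x + x))%R, false).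
Proof.
rewrite /commg /conjg /quad_seq !(dihedralME, dihedralVE) /dihedral_mul /dihedral_inv /=.
by congr pair; lia.
Qed.

Lemma lower_central_translation (n : nat) :
  exists2 x : int, x != 0%R &
    lower_central n (generated (range quad_seq)) (x, false).
Proof.
elim: n => [|n [x x0 Kx]].
  (* [quad_seq 2] is a translation, 2 being even; each commutator with [quad_seq 1] then multiplies
     it by -2. *)
  by exists 2%R => //; apply: sub_generated; exists 2%R.
exists (- (x + x))%R; first by lia.
apply: sub_generated; exists (x, false) => //; exists (quad_seq 1).
  by apply: sub_generated; exists 1%R.
exact: commg_translation.
Qed.

Theorem corollary2p9 :
  exists (G : groupType) (T : int -> G),
    [/\ leibman 2 T,
        T 0%R = 1%g
      & ~ nilpotent_subgroup (generated (range T))].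
Proof.
exists dihedral, quad_seq; split=> //; first exact: quad_seq_leibman.
move=> [n Kn1]; have [x x0] := lower_central_translation n.
by rewrite Kn1 => -[x1]; rewrite x1 in x0.
Qed.
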